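(* Let $n,k\ge 1$, let $X\in\mathbb{R}^{n\times k}$ be a fixed matrix, and let $Y$ be a random $n\times k$ matrix whose entries are independent along each row and follow one of the noise models below. For $\Theta\in\mathbb{R}^{k\times k}$ let $\mathcal{R}_\Theta(X)=\mathbb{E}\|Y\Theta-X\|_F^2$. Let $Q=X^\top X+D$, where $D\in\mathbb{R}^{k\times k}$ is the diagonal matrix $$D=\begin{cases} n\sigma^2 I_k & \text{if } Y_{i,j}\sim\mathcal{N}(X_{i,j},\sigma^2) \text{ (homoscedastic Gaussian noise)},\\ \operatorname{diag}(V^\top\mathbf{1}_n) & \text{if } Y_{i,j}\sim\mathcal{N}(X_{i,j},V_{i,j}) \text{ (heteroscedastic Gaussian noise)},\\ \operatorname{diag}(X^\top\mathbf{1}_n) & \text{if } Y_{i,j}\sim\mathcal{P}(X_{i,j}) \text{ (Poisson noise)},\\ \operatorname{diag}((aX+b)^\top\mathbf{1}_n) & \text{if } Y_{i,j}\sim a\mathcal{P}(X_{i,j}/a)+\mathcal{N}(0,b) \text{ (mixed Poisson-Gaussian noise)}.\end{cases}$$ If $Q$ is positive definite, then $$\mathop{\arg\min}_{\Theta\in\mathbb{R}^{k\times k}}\mathcal{R}_\Theta(X)=I_k-Q^{-1}D,$$ $$\mathop{\arg\min}_{\Theta\in\mathbb{R}^{k\times k},\ \Theta^\top\mathbf{1}_k=\mathbf{1}_k}\mathcal{R}_\Theta(X)=I_k-\left[Q^{-1}-\frac{Q^{-1}\mathbf{1}_k(Q^{-1}\mathbf{1}_k)^\top}{\mathbf{1}_k^\top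 Q^{-1}\mathbf{1}_k}\right]D .$$
   Context: $\|\cdot\|_F$ is the Frobenius norm, $\mathbf{1}_m$ is the all-ones vector in $\mathbb{R}^m$, $I_k$ the identity matrix, and $\operatorname{diag}(v)$ the diagonal matrix with diagonal $v$. ''Independent along each row'' means that for each $i$ the random variables $Y_{i,1},\dots,Y_{i,k}$ are independent. $\mathcal{N}(m,v)$ is the Gaussian law with mean $m$ and variance $v$; $\mathcal{P}(\lambda)$ is the Poisson law with mean $\lambda$. Here $\sigma>0$, $V$ is a fixed $n\times k$ matrix with positive entries, and $a,b>0$. In the Poisson and mixed cases the entries of $X$ are nonnegative ($\mathcal{P}(0)$ being the point mass at $0$). The notation $a\mathcal{P}(x/a)+\mathcal{N}(0,b)$ denotes the law of $aN+\varepsilon$ with $N\sim\mathcal{P}(x/a)$ and $\varepsilon\sim\mathcal{N}(0,b)$ independent. In $aX+b$ the scalar $b$ is added to every entry. *)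

(* Defs.v *)
From HB Require Import structures.
From mathcomp Require Import all_boot all_order all_algebra.
From mathcomp Require Import all_classical all_reals all_analysis.

Set Implicit Arguments.
Unset Strict Implicit.
Unset Printing Implicit Defensive.

Import Order.TTheory GRing.Theory Num.Theory.
Import numFieldNormedType.Exports.

Local Open Scope classical_set_scope.
Local Open Scope ring_scope.

Section linear_algebra.
Context {R : rcfType}.

Definition frobenius_norm m n (A : 'M[R]_(m, n)) : R :=
  Num.sqrt (\sum_(i < m) \sum_(j < n) A i j ^+ 2).

Definition ones m : 'cV[R]_m := const_mx 1.

(* [diag_mx] expects a row vector. *)
Definition diag_cv m (v : 'cV[R]_m) : 'M[R]_m := diag_mx v^T.

Definition posdefmx m (A : 'M[R]_m) : Prop :=
  A^T = A /\ forall v : 'cV[R]_m, v != 0 -> 0 < (v^T *m A *m v) 0 0.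

End linear_algebra.

Definition argmin {A : Type} {R : realType} (S : set A) (f : A -> \bar R)
    : set A :=
  [set x | S x /\ forall y, S y -> (f x <= f y)%E].

Definition mutually_independent d (T : measurableType d) (R : realType)
    (P : probability T R) (I : finType) (Z : I -> {RV P >-> R}) : Prop :=
  forall (J : {set I}) (B : I -> set R),
    (forall i, measurable (B i)) ->
    P (\bigcap_(i in [set` J]) (Z i @^-1` B i)) =
    (\prod_(i in J) P (Z i @^-1` B i))%E.

Section laws.
Context {R : realType}.

(* [normal_prob] is parameterized by the standard deviation, [gaussian_law] by
   the variance [v]. *)
Definition gaussian_law (m v : R) : set R -> \bar R :=
  normal_prob m (Num.sqrt v).

(* [poisson_prob] is a law on [nat]; its second argument is not used, and it is
   the Dirac mass at 0 when the rate is 0. *)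
Definition poisson_law (lambda : R) : set R -> \bar R :=
  pushforward (poisson_prob lambda 0) (fun N : nat => N%:R : R).

(* The law of [a * N + e] for independent [N] (Poisson of mean [x / a]) and [e]
   (centered Gaussian of variance [b]). *)
Definition poisson_gaussian_law (a b x : R) : set R -> \bar R :=
  pushforward
    (poisson_prob (x / a) 0 \x normal_prob (0 : R) (Num.sqrt b))%E
    (fun Ne : nat * R => a * Ne.1%:R + Ne.2 : R).

End laws.

Inductive noise_model (R : realType) (n k : nat) : Type :=
| HomoscedasticGaussian (sigma : R)
| HeteroscedasticGaussian (V : 'M[R]_(n, k))
| PoissonNoise
| MixedPoissonGaussian (a b : R).

Arguments PoissonNoise {R n k}.

Section noise.
Context {R : realType} {n k : nat}.
Implicit Types (N : noise_model R n k) (X : 'M[R]_(n, k)).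

Definition admissible N X : Prop :=
  match N with
  | HomoscedasticGaussian sigma => 0 < sigma
  | HeteroscedasticGaussian V => forall i j, 0 < V i j
  | PoissonNoise => forall i j, 0 <= X i j
  | MixedPoissonGaussian a b =>
      [/\ 0 < a, 0 < b & forall i j, 0 <= X i j]
  end.

Definition noise_law N X (i : 'I_n) (j : 'I_k) : set R -> \bar R :=
  match N with
  | HomoscedasticGaussian sigma => gaussian_law (X i j) (sigma ^+ 2)
  | HeteroscedasticGaussian V => gaussian_law (X i j) (V i j)
  | PoissonNoise => poisson_law (X i j)
  | MixedPoissonGaussian a b => poisson_gaussian_law a b (X i j)
  end.

Definition noise_diag N X : 'M[R]_k :=
  match N with
  | HomoscedasticGaussian sigma => (n%:R * sigma ^+ 2)%:M
  | HeteroscedasticGaussian V => diag_cv (V^T *m ones n)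
  | PoissonNoise => diag_cv (X^T *m ones n)
  | MixedPoissonGaussian a b => diag_cv ((a *: X + const_mx b)^T *m ones n)
  end.

End noise.

Section observation.
Context {d : measure_display} {T : measurableType d} {R : realType}.
Context (P : probability T R) {n k : nat}.
Variable Y : 'I_n -> 'I_k -> {RV P >-> R}.

Definition follows_noise (N : noise_model R n k) (X : 'M[R]_(n, k)) : Prop :=
  forall i j (A : set R), measurable A ->
    distribution P (Y i j) A = noise_law N X i j A.

Definition independent_along_rows : Prop :=
  forall i, mutually_independent (Y i).

Definition observed_mx (w : T) : 'M[R]_(n, k) := \matrix_(i, j) Y i j w.

Definition risk (X : 'M[R]_(n, k)) (Theta : 'M[R]_k) : \bar R :=
  ('E_P[fun w => (frobenius_norm (observed_mx w *m Theta - X) ^+ 2)%R])%E.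

End observation.

(* Main.v *)
(* Only the first two moments of the entries matter: along each row the entries
   have means [X i j], variances [v i j] and are uncorrelated, so the risk is
   \tr ((Theta - 1)^T X^T X (Theta - 1)) + \tr (Theta^T D Theta) with D the
   diagonal matrix of the column sums of [v]. Its gradient is
   2 (Q Theta - X^T X); at the announced points Q Theta - X^T X is 0,
   respectively [ones k *m r^T] for a Lagrange multiplier [r], which is
   orthogonal to the feasible directions. Completing the square there leaves
   \tr (H^T Q H), positive for H <> 0. *)

Require Import Defs.
From mathcomp Require Import all_boot all_order all_algebra.
From mathcomp Require Import all_classical all_reals all_analysis.
From mathcomp Require Import measurable_realfun.
From mathcomp Require Import ring lra.

Import Order.TTheory GRing.Theory Num.Theory.
Import numFieldNormedType.Exports.

Set Implicit Arguments.
Unset Strict Implicit.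
Unset Printing Implicit Defensive.

Local Open Scope classical_set_scope.
Local Open Scope ring_scope.

(** * Functions with a given finite integral *)

Section has_integral.
Context {d : measure_display} {T : measurableType d} {R : realType}.
Implicit Types mu nu : {measure set T -> \bar R}.

(** Integrability and value are bundled, so that moments are combined linearly in [R] without side
    conditions on infinite values. *)
Definition has_integral mu (f : T -> R) (c : R) : Prop :=
  mu.-integrable [set: T] (EFin \o f) /\ (\int[mu]_x (f x)%:E = c%:E)%E.

Lemma has_integral_measurable mu f c :
  has_integral mu f c -> measurable_fun [set: T] f.
Proof. by move=> [/measurable_int /measurable_EFinP]. Qed.

Lemma has_integral_ge0 mu (f : T -> R) c :
  measurable_fun [set: T] f -> (forall x, 0 <= f x) ->
  (\int[mu]_x (f x)%:E = c%:E)%E -> has_integral mu f c.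
Proof.
move=> mf f0 fc; split=> //; apply/integrableP; split.
  exact/measurable_EFinP.
under eq_integral do rewrite /= ger0_norm//.
by rewrite fc ltry.
Qed.

Lemma eq_has_integral mu f g c c' :
  has_integral mu f c -> f =1 g -> c = c' -> has_integral mu g c'.
Proof. by move=> + /funext <- <-. Qed.

Lemma has_integralD mu f g a b : has_integral mu f a -> has_integral mu g b ->
  has_integral mu (f \+ g) (a + b).
Proof.
move=> [If fa] [Ig gb]; split.
  exact: eq_integrable (integrableD measurableT If Ig).
by rewrite (integralD_EFin measurableT If Ig) fa gb.
Qed.

Lemma has_integralZ mu k f a : has_integral mu f a ->
  has_integral mu (fun x => k * f x) (k * a).
Proof.
move=> [If fa]; split.
  exact: eq_integrable (integrableZl measurableT k If).
under eq_integral do rewrite EFinM.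
by rewrite (integralZl measurableT If) fa.
Qed.

Lemma has_integral0 mu : has_integral mu (fun=> 0) 0.
Proof. by split; [exact: integrable0|exact: integral0]. Qed.

Lemma has_integral_sum mu (I : Type) (s : seq I) (Q : pred I) f a :
  (forall i, Q i -> has_integral mu (f i) (a i)) ->
  has_integral mu (fun x => \sum_(i <- s | Q i) f i x) (\sum_(i <- s | Q i) a i).
Proof.
move=> fa; elim: s => [|i s ih].
  by apply: eq_has_integral (has_integral0 mu) _ _ => [x|]; rewrite big_nil.
rewrite big_cons; case: ifPn => Qi; last first.
  by apply: eq_has_integral ih _ _ => // x; rewrite big_cons (negbTE Qi).
apply: eq_has_integral (has_integralD (fa _ Qi) ih) _ _ => // x.
by rewrite big_cons Qi.
Qed.

Lemma has_integral_cst (P : probability T R) k : has_integral P (fun=> k) k.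
Proof.
split; first exact: finite_measure_integrable_cst.
by rewrite integral_cst//= probability_setT mule1.
Qed.

(** For integrals whose value is only identified afterwards, such as the first Gaussian moment,
    found by symmetry. *)
Lemma le_has_integral mu (f g : T -> R) c : has_integral mu g c ->
  measurable_fun [set: T] f -> (forall x, `|f x| <= g x) ->
  exists c', has_integral mu f c'.
Proof.
move=> [Ig _] mf fg.
have If : mu.-integrable [set: T] (EFin \o f).
  apply: le_integrable Ig => //; first exact/measurable_EFinP.
  by move=> x _ /=; rewrite lee_fin (le_trans (fg x))// ler_norm.
exists (fine (\int[mu]_x (f x)%:E)%E); split=> //.
by rewrite fineK// integrable_fin_num.
Qed.

Lemma eq_measure_has_integral mu nu f c :
  (forall A, measurable A -> nu A = mu A) ->
  has_integral mu f c -> has_integral nu f c.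
Proof.
move=> numu [/integrableP[mf foo] fc]; split.
  apply/integrableP; split=> //.
  by rewrite (eq_measure_integral mu)// => A mA _; exact: numu.
by rewrite (eq_measure_integral mu)// => A mA _; exact: numu.
Qed.

End has_integral.

(** Change of variables. Agreement of [nu] with the image measure is asked on measurable sets only,
    as in [follows_noise]. Both directions serve: from a model space to a law on [R], then from this
    law to the sample space. *)
Lemma has_integral_pushforward {d d' : measure_display} {T : measurableType d}
    {T' : measurableType d'} {R : realType} (mu : {measure set T -> \bar R})
    (nu : {measure set T' -> \bar R}) (phi : T -> T') (f : T' -> R) (c : R) :
  measurable_fun [set: T] phi -> measurable_fun [set: T'] f ->
  (forall A, measurable A -> nu A = mu (phi @^-1` A)) ->
  has_integral nu f c <-> has_integral mu (f \o phi) c.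
Proof.
move=> mphi mf numu.
have nuE : forall A, measurable A -> A `<=` [set: T'] ->
    nu A = pushforward mu phi A.
  by move=> A mA _; exact: numu.
have mEf : measurable_fun [set: T'] (EFin \o f) by exact/measurable_EFinP.
have intE : mu.-integrable [set: T] (EFin \o f \o phi) ->
    (\int[nu]_x (f x)%:E = \int[mu]_x (f (phi x))%:E)%E.
  move=> If; rewrite (eq_measure_integral (pushforward mu phi))//.
  by rewrite (@integral_pushforward _ _ _ _ _ _ mphi mu setT (EFin \o f)).
split=> -[If fc].
  have If' : mu.-integrable [set: T] (EFin \o f \o phi).
    apply/integrableP; split; first exact: (measurableT_comp mEf mphi).
    move/integrableP : If => [_]; apply: le_lt_trans.
    rewrite (eq_measure_integral (pushforward mu phi))//.
    rewrite (ge0_integral_pushforward mphi)//.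
    exact: measurableT_comp.
  by split=> //; rewrite -intE.
split; last by rewrite intE.
have /integrableP[_ foo] :=
  @integrable_pushforward _ _ _ _ _ _ mphi mu setT (EFin \o f) mEf If measurableT.
apply/integrableP; split=> //.
by rewrite (eq_measure_integral (pushforward mu phi)).
Qed.

Lemma has_integral_prod {d1 d2 : measure_display} {T1 : measurableType d1}
    {T2 : measurableType d2} {R : realType} (P1 : probability T1 R)
    (P2 : probability T2 R) (f : T1 -> R) (g : T2 -> R) a b :
  has_integral P1 f a -> has_integral P2 g b ->
  has_integral (P1 \x P2)%E (fun z => f z.1 * g z.2) (a * b).
Proof.
move=> hf hg.
have [[If fa] [Ig gb]] := (hf, hg).
have mf := has_integral_measurable hf.
have mg := has_integral_measurable hg.
have mfg : measurable_fun [set: T1 * T2] (fun z => (f z.1 * g z.2)%:E).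
  apply/measurable_EFinP; apply: measurable_funM.
    exact: measurableT_comp.
  exact: measurableT_comp.
have Ifg : (P1 \x P2)%E.-integrable [set: T1 * T2] (fun z => (f z.1 * g z.2)%:E).
  (* Tonelli: the iterated integral of the absolute value factors into a product of two finite
     numbers. *)
  apply/integrable12ltyP => //=.
  have Ig' := integrable_norm Ig.
  under eq_integral => x _.
    under eq_integral do rewrite normrM EFinM.
    rewrite (integralZl measurableT Ig') muleC.
    over.
  rewrite -(fineK (integrable_fin_num measurableT Ig')).
  rewrite (integralZl measurableT (integrable_norm If)).
  rewrite -(fineK (integrable_fin_num measurableT (integrable_norm If))).
  by rewrite -EFinM ltry.
split=> //.
rewrite -(integral12_prod_meas1 Ifg) /fubini_F/=.
under eq_integral => x _.
  under eq_integral do rewrite EFinM.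
  rewrite (integralZl measurableT Ig) gb muleC.
  over.
by rewrite (integralZl measurableT If) fa muleC.
Qed.

(** Independence makes the law of the pair agree with the product of the two laws on rectangles,
    which determine the product measure; Fubini then applies to the product of the coordinates. *)
Lemma has_integral_indepM {d : measure_display} {T : measurableType d}
    {R : realType} (P : probability T R) (Y Z : {RV P >-> R}) a b :
  (forall A B, measurable A -> measurable B ->
    P (Y @^-1` A `&` Z @^-1` B) = (P (Y @^-1` A) * P (Z @^-1` B))%E) ->
  has_integral P Y a -> has_integral P Z b ->
  has_integral P (fun w => Y w * Z w) (a * b).
Proof.
move=> YZ hY hZ.
have mY : measurable_fun [set: T] Y by [].
have mZ : measurable_fun [set: T] Z by [].
have mYZ : measurable_fun [set: T] (fun w => (Y w, Z w)).
  exact: measurable_fun_pair.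
have hY' : has_integral (distribution P Y) (@idfun R) a.
  apply: (iffRL (has_integral_pushforward (f := @idfun R) _ mY _ _) hY) => //.
  exact: measurable_id.
have hZ' : has_integral (distribution P Z) (@idfun R) b.
  apply: (iffRL (has_integral_pushforward (f := @idfun R) _ mZ _ _) hZ) => //.
  exact: measurable_id.
have h := has_integral_prod hY' hZ'.
have mm : measurable_fun [set: R * R] (fun z : R * R => z.1 * z.2).
  exact: measurable_funM.
refine (iffLR (has_integral_pushforward (mu := P)
  (nu := (distribution P Y \x distribution P Z)%E)
  (f := fun z => z.1 * z.2) _ mYZ mm _) h).
move=> A mA.
apply: (@product_measure_unique _ _ _ _ _ (distribution P Y) (distribution P Z)
  (pushforward P (fun w => (Y w, Z w)))) => // B C mB mC; exact: YZ.
Qed.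

Lemma mutually_independent_pair {d : measure_display} {T : measurableType d}
    {R : realType} (P : probability T R) (I : finType) (Z : I -> {RV P >-> R})
    (i j : I) A B :
  mutually_independent Z -> i != j -> measurable A -> measurable B ->
  P (Z i @^-1` A `&` Z j @^-1` B) = (P (Z i @^-1` A) * P (Z j @^-1` B))%E.
Proof.
move=> Zind ij mA mB.
(* Independence on two indices, with a family of events equal to [A] at [i] and to [B] everywhere
   else. *)
have := Zind [set i; j]%SET (fun l => if l == i then A else B).
rewrite big_setU1/= ?inE// big_set1 eqxx eq_sym (negbTE ij) => <-; last first.
  by move=> l; case: ifP.
congr (P _); apply/seteqP; split=> w /=.
  move=> [Aw Bw] l /=; rewrite !inE => /orP[] /eqP ->; first by rewrite eqxx.
  by rewrite eq_sym (negbTE ij).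
move=> h; split.
  by have := h i; rewrite /= eqxx !inE eqxx; apply.
by have := h j; rewrite /= eq_sym (negbTE ij) !inE eqxx orbT; apply.
Qed.

(** * Integration against a measure with a density *)

Section density.
Context {d : measure_display} {T : measurableType d} {R : realType}.
Variables (mu : {sigma_finite_measure set T -> \bar R}).
Variables (nu : {finite_measure set T -> \bar R}) (p : T -> R).
Hypotheses (numu : nu `<< mu) (mp : measurable_fun [set: T] p).
Hypothesis p_ge0 : forall x, 0 <= p x.
Hypothesis nuE :
  (forall A, measurable A -> nu A = \int[mu]_(x in A) (p x)%:E)%E.

(** [p] and the Radon-Nikodym derivative have the same integral over every measurable set, hence
    agree almost everywhere, and the change of variables known for the derivative passes to [p]. *)
Lemma ge0_integral_density (f : T -> \bar R) :
  measurable_fun [set: T] f -> (forall x, 0 <= f x)%E ->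
  (\int[nu]_x f x = \int[mu]_x (f x * (p x)%:E))%E.
Proof.
move=> mf f0.
rewrite -(Radon_Nikodym_SigmaFinite.change_of_variables numu)//.
have Ig := Radon_Nikodym_SigmaFinite.f_integrable numu.
have mg := measurable_int _ Ig.
have mpE : measurable_fun [set: T] (EFin \o p) by exact/measurable_EFinP.
apply: ge0_ae_eq_integral => //.
- exact: emeasurable_funM.
- exact: emeasurable_funM.
- by move=> x _; rewrite mule_ge0// Radon_Nikodym_SigmaFinite.f_ge0.
- by move=> x _; rewrite mule_ge0// lee_fin.
apply: ae_eqe_mul2l; apply: (integral_ae_eq measurableT Ig mpE) => E _ mE.
by rewrite -Radon_Nikodym_SigmaFinite.f_integral// nuE.
Qed.

Lemma ge0_has_integral_density (f : T -> R) c :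
  measurable_fun [set: T] f -> (forall x, 0 <= f x) ->
  has_integral mu (fun x => f x * p x) c -> has_integral nu f c.
Proof.
move=> mf f0 [_ fc]; apply: has_integral_ge0 => //.
rewrite ge0_integral_density//; first exact/measurable_EFinP.
Qed.

(* [f = (|f| + f) - |f|] is a difference of nonnegative functions. *)
Lemma has_integral_density (f : T -> R) c :
  measurable_fun [set: T] f ->
  has_integral mu (fun x => f x * p x) c -> has_integral nu f c.
Proof.
move=> mf hf.
have mnf : measurable_fun [set: T] (fun x => `|f x|) by exact: measurableT_comp.
have [c1 hnf] : exists c1, has_integral mu (fun x => `|f x| * p x) c1.
  exists (fine (\int[mu]_x (`|f x| * p x)%:E)%E).
  have := integrable_norm hf.1.
  under [X in _.-integrable _ X]eq_fun do rewrite /= normrM (ger0_norm (p_ge0 _)).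
  move=> Inf; split=> //.
  by rewrite fineK// integrable_fin_num.
have h1 : has_integral nu (fun x => `|f x|) c1.
  exact: ge0_has_integral_density.
have h2 : has_integral nu (fun x => `|f x| + f x) (c1 + c).
  apply: ge0_has_integral_density => [|x|].
  - exact: measurable_funD.
  - by have := ler_norm (- f x); rewrite normrN; lra.
  - apply: eq_has_integral (has_integralD hnf hf) _ _ => // x /=.
    by rewrite mulrDl.
apply: eq_has_integral (has_integralD h2 (has_integralZ (-1) h1)) _ _.
  by move=> x /=; ring.
by ring.
Qed.

End density.

(** * Moments of the noise laws *)

(** For a positive rate the Poisson measure is a series of Dirac masses weighted by
    [poisson_pmf]. *)
Lemma ge0_integral_poisson {R : realType} (l : R) (f : nat -> R) :
  0 < l -> (forall k, 0 <= f k) ->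
  (\int[poisson_prob l 0]_k (f k)%:E =
   \sum_(k <oo) (f k * poisson_pmf l k)%:E)%E.
Proof.
move=> l0 f0.
pose w k := NngNum (poisson_pmf_ge0 l k).
rewrite (eq_measure_integral (mseries (fun k => mscale (w k) \d_k) 0)); last first.
  move=> A _ _; rewrite /= /poisson_prob l0 /mseries.
  rewrite -[in LHS](set_mem_set A) -nneseries_esum; last first.
    by move=> k _; rewrite lee_fin poisson_pmf_ge0.
  rewrite eseries_mkcond; apply: eq_eseriesr => k _.
  transitivity ((poisson_pmf l k)%:E * (k \in A)%:R%:E)%E; last by [].
  by case: ifPn; rewrite ?mule1 ?mule0.
rewrite ge0_integral_measure_series//; last by move=> k _; rewrite lee_fin.
apply: eq_eseriesr => k _.
rewrite ge0_integral_mscale//; last by move=> x _; rewrite lee_fin.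
by rewrite integral_dirac// diracT mul1e muleC.
Qed.

(* The Chen-Stein identity for the Poisson law. *)
Lemma has_integral_poisson_shift {R : realType} (l : R) (f : nat -> R) c :
  0 < l -> (forall k, 0 <= f k) ->
  has_integral (poisson_prob l 0) (fun k => f k.+1) c ->
  has_integral (poisson_prob l 0) (fun k => k%:R * f k) (l * c).
Proof.
move=> l0 f0 [_ fc]; apply: has_integral_ge0 => //.
  by move=> k; rewrite mulr_ge0.
rewrite EFinM -fc !ge0_integral_poisson//; last first.
  by move=> k; rewrite mulr_ge0.
rewrite -nneseriesZl; last first.
  by move=> k _; rewrite lee_fin mulr_ge0 ?poisson_pmf_ge0.
(* The term of index 0 vanishes; after the shift of index, the identity [k.+1%:R * poisson_pmf l
   k.+1 = l * poisson_pmf l k] matches the series term by term. *)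
rewrite nneseries_recl//; last first.
  by move=> k _; rewrite lee_fin !mulr_ge0 ?poisson_pmf_ge0.
rewrite mul0r mul0r add0e -nneseries_addn; last first.
  by move=> k; rewrite lee_fin !mulr_ge0 ?poisson_pmf_ge0.
apply: eq_eseriesr => k _; rewrite addn1 -EFinM; congr EFin.
rewrite /poisson_pmf l0 factS natrM invfM exprS.
have k0 : k.+1%:R != 0 :> R by rewrite pnatr_eq0.
have kf0 : k`!%:R != 0 :> R by rewrite pnatr_eq0 -lt0n fact_gt0.
by field; apply/andP; split.
Qed.

(** At rate 0 the law is a Dirac mass. Otherwise the shift identity with [f = 1] gives the mean [l],
    and with [f k = k%:R] the second moment [l * (l + 1)]. *)
Lemma poisson_moments {R : realType} (l : R) : 0 <= l ->
  has_integral (poisson_prob l 0) (fun k => k%:R) l /\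
  has_integral (poisson_prob l 0) (fun k => k%:R ^+ 2) (l ^+ 2 + l).
Proof.
rewrite le_eqVlt => /predU1P[<-|l0].
  have E (f : nat -> R) : (forall k, 0 <= f k) ->
      has_integral (poisson_prob (0 : R) 0) f (f 0%N).
    move=> f0; apply: (eq_measure_has_integral (mu := \d_0%N)).
      by move=> A _; rewrite /= /poisson_prob ltxx.
    by apply: has_integral_ge0 => //; rewrite integral_dirac// diracT mul1e.
  split; first by apply: E => k.
  apply: eq_has_integral (E (fun k => k%:R ^+ 2) _) _ _ => //; last first.
  by rewrite !expr0n/= addr0.
have h1 : has_integral (poisson_prob l 0) (fun k => k%:R) l.
  apply: eq_has_integral
    (has_integral_poisson_shift l0 (f := fun=> 1) (c := 1) _ _) _ _.
  - by [].
  - exact: has_integral_cst.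
  - by move=> k; rewrite mulr1.
  - by rewrite mulr1.
split=> //.
apply: eq_has_integral
  (has_integral_poisson_shift l0 (f := fun k => k%:R) (c := l + 1) _ _) _ _.
- by [].
- apply: eq_has_integral (has_integralD h1 (has_integral_cst _ 1)) _ _ => // k.
  by rewrite -natr1.
- by move=> k; rewrite expr2.
- by rewrite mulrDr mulr1 expr2.
Qed.

(** * Second moment of the centered Gaussian density *)

Section gaussian.
Context {R : realType}.
Notation leb := (@lebesgue_measure R).
Variables (s : R).
Hypothesis s0 : 0 < s.
Let phi := normal_pdf 0 s.
Let pk : R := normal_peak s.
(** Closed form of [phi], the one that is differentiated below. *)
Let h (x : R) : R := pk * expR ((- (2 * s ^+ 2)^-1) * x ^+ 2).

Let phiE : phi = h.
Proof.
apply/funext => x; rewrite /phi normal_pdfE ?gt_eqF// /h /normal_fun subr0.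
by congr (_ * expR _); rewrite -[s ^+ 2 *+ 2]mulr_natl !mulNr mulrC.
Qed.

(* An antiderivative of [(x ^+ 2 - s ^+ 2) * h x], whose sign changes at [s]:
   hence the separate treatment of [0, s] and [s, +oo[. *)
Let F (x : R) : R := - s ^+ 2 * x * h x.

Let dh (x : R) : is_derive x (1 : R) h (- (s ^+ 2)^-1 * x * h x).
Proof.
apply: is_derive_eq; rewrite /GRing.scale/= /h; set e := expR _.
by field; rewrite gt_eqF.
Qed.

Let dF (x : R) : is_derive x (1 : R) F ((x ^+ 2 - s ^+ 2) * h x).
Proof.
have dhx := dh x.
apply: is_derive_eq; rewrite /GRing.scale/=.
by field; rewrite gt_eqF.
Qed.

Let ch : continuous h.
Proof. by rewrite -phiE; apply: continuous_normal_pdf; rewrite gt_eqF. Qed.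

Let cF : continuous F.
Proof.
move=> x; apply: differentiable_continuous; apply/derivable1_diffP.
exact: ex_derive.
Qed.

Let cxh (a b : R) : continuous (fun x : R => (a * x ^+ 2 + b) * h x).
Proof.
move=> x; apply: cvgM; last exact: ch.
apply: cvgD; last exact: cvg_cst.
apply: cvgM; [exact: cvg_cst|exact: exprn_continuous].
Qed.

Let h_ge0 x : 0 <= h x.
Proof. by rewrite mulr_ge0 ?normal_peak_ge0 ?expR_ge0. Qed.

(** With [y = x ^+ 2 / (2 * s ^+ 2)], the bound [expR (- y) <= y^-1] follows from [1 + y <= expR y]
    and gives [K / x] as a bound on the absolute value of [F x]. *)
Let F_cvg0 : F x @[x --> +oo%R] --> (0 : R).
Proof.
pose K := 2 * s ^+ 4 * pk.
have K0 : 0 <= K by rewrite !mulr_ge0 ?normal_peak_ge0 ?exprn_ge0 ?ltW.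
have FK x : 0 < x -> `|F x| <= K / x.
  move=> x0; rewrite /F normrM (ger0_norm (h_ge0 x)) normrM normrN.
  rewrite (gtr0_norm x0) (@gtr0_norm _ (s ^+ 2)) ?exprn_gt0// /h.
  have y0 : 0 < (2 * s ^+ 2)^-1 * x ^+ 2.
    by rewrite mulr_gt0 ?invr_gt0 ?mulr_gt0 ?exprn_gt0.
  have ey : expR (- (2 * s ^+ 2)^-1 * x ^+ 2) <= ((2 * s ^+ 2)^-1 * x ^+ 2)^-1.
    rewrite mulNr expRN lef_pV2 ?posrE ?expR_gt0//.
    by rewrite (le_trans _ (expR_ge1Dx _))// lerDr.
  apply: (@le_trans _ _ (s ^+ 2 * x * (pk * ((2 * s ^+ 2)^-1 * x ^+ 2)^-1))).
    apply: ler_wpM2l; first by rewrite mulr_ge0 ?exprn_ge0 ?ltW.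
    by apply: ler_wpM2l => //; exact: normal_peak_ge0.
  rewrite /K le_eqVlt; apply/orP; left; apply/eqP.
  by field; rewrite ?gt_eqF.
apply/cvgrPdist_le => e e0; near=> x.
rewrite sub0r normrN; have x0 : 0 < x by near: x; exact: nbhs_pinfty_gt.
rewrite (le_trans (FK _ x0))// ler_pdivrMr// mulrC -ler_pdivrMr//.
Unshelve. all: by end_near. Qed.

(** [F] runs from [- s ^+ 3 * h s] at [s] to 0 at infinity. The integral over [[0, s]] below, with
    the opposite integrand, has the same value, so that the two boundary terms cancel in the second
    moment. *)
Let int_tail :
  (\int[leb]_(x in `[s, +oo[) ((x ^+ 2 - s ^+ 2) * h x)%:E = (s ^+ 3 * h s)%:E)%E.
Proof.
rewrite (@ge0_continuous_FTC2y _ _ F s 0)//.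
- by rewrite -EFinB; congr EFin; rewrite /F; ring.
- by move=> x sx; rewrite mulr_ge0// subr_ge0 lerXn2r// nnegrE ltW// (lt_le_trans s0).
- apply: continuous_subspaceT; under eq_fun do rewrite -[_ ^+ 2]mul1r.
  exact: cxh.
- by apply: cvg_at_right_filter; exact: cF.
- by move=> x _; rewrite derive1E; apply: derive_val.
Qed.

Let int_head :
  (\int[leb]_(x in `[0%R, s]) ((s ^+ 2 - x ^+ 2) * h x)%:E = (s ^+ 3 * h s)%:E)%E.
Proof.
rewrite (@continuous_FTC2 _ _ (- F) 0 s)//.
- by rewrite -EFinB; congr EFin; rewrite /F !fctE; ring.
- apply: continuous_subspaceT.
  under eq_fun do rewrite addrC -mulN1r.
  exact: cxh.
- split.
  + by move=> x _.
  + by apply: cvg_at_right_filter; apply: cvgN; exact: cF.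
  + by apply: cvg_at_left_filter; apply: cvgN; exact: cF.
- move=> x _; rewrite derive1E deriveN// (@derive_val _ _ _ _ _ _ _ (dF x)); ring.
Qed.

Let itvcyE : [set x : R | 0 <= x] = `[0, s]%classic `|` `]s, +oo[%classic.
Proof.
apply/seteqP; split=> x /=; rewrite !in_itv/= ?andbT.
  by move=> x0; case: (leP x s) => xs; [left; rewrite x0|right].
by case=> [/andP[]//|/ltW sx]; rewrite (le_trans _ sx)// ltW.
Qed.

Let integral_ge0_split (f : R -> R) : continuous f -> (forall x, 0 <= f x) ->
  (\int[leb]_(x in [set x : R | (0 <= x)%R]) (f x)%:E =
   \int[leb]_(x in `[0%R, s]) (f x)%:E + \int[leb]_(x in `[s, +oo[) (f x)%:E)%E.
Proof.
move=> cf f0; have mf := continuous_measurable_fun cf.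
have mfE (D : set R) : measurable_fun D (EFin \o f).
  by apply/measurable_EFinP; exact: measurable_funTS.
rewrite itvcyE ge0_integral_setU//=.
(* The union is disjoint because [s] is left out of the tail; as a null set it can be put back. *)
- by rewrite integral_itv_obnd_cbnd//; exact: mfE.
- exact: mfE.
- by move=> x _; rewrite lee_fin.
- apply/disj_setPS => x /= []; rewrite !in_itv/= andbT => /andP[_ xs].
  by rewrite ltNge xs.
Qed.

Let half_integral_h :
  (\int[leb]_(x in [set x : R | (0 <= x)%R]) (h x)%:E = (2^-1)%:E)%E.
Proof.
have : (2%:E * \int[leb]_(x in [set x : R | (0 <= x)%R]) (h x)%:E = 1)%E.
  rewrite -ge0_symfun_integralT//.
    by rewrite -phiE integral_normal_pdf.
  by move=> x /=; rewrite /h sqrrN.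
set I := (\int[_]_(_ in _) _)%E.
(* An infinite [I] would contradict [2 * I = 1]. *)
case: I => [r| |] /=.
- by move=> [] r1; congr EFin; lra.
- by rewrite gt0_muley// lte_fin.
- by rewrite gt0_muleNy// lte_fin.
Qed.

(** Head and tail satisfy [a + s ^+ 3 * h s = s ^+ 2 * p0] and [b = s ^+ 3 * h s + s ^+ 2 * p1];
    adding them gives [a + b = s ^+ 2 * (p0 + p1)], where [p0 + p1] is one half. *)
Let half_integral_sqr_h :
  (\int[leb]_(x in [set x : R | (0 <= x)%R]) (x ^+ 2 * h x)%:E =
   (2^-1 * s ^+ 2)%:E)%E.
Proof.
have x2hE : (fun x : R => x ^+ 2 * h x) = (fun x => (1 * x ^+ 2 + 0) * h x).
  by apply/funext => x; rewrite mul1r addr0.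
have cx2h : continuous (fun x : R => x ^+ 2 * h x) by rewrite x2hE; exact: cxh.
have m (f : R -> R) (D : set R) : continuous f -> measurable_fun D (EFin \o f).
  move=> cf; apply/measurable_EFinP; apply: measurable_funTS.
  exact: continuous_measurable_fun.
have x2h0 x : 0 <= x ^+ 2 * h x by rewrite mulr_ge0// sqr_ge0.
have := half_integral_h.
rewrite !integral_ge0_split//.
set p0 := (\int[leb]_(x in `[0%R, s]) (h x)%:E)%E.
set p1 := (\int[leb]_(x in `[s, +oo[) (h x)%:E)%E.
set a := (\int[leb]_(x in `[0%R, s]) (x ^+ 2 * h x)%:E)%E.
set b := (\int[leb]_(x in `[s, +oo[) (x ^+ 2 * h x)%:E)%E.
have s20 : 0 <= s ^+ 2 by rewrite sqr_ge0.
have bE : (b = (s ^+ 3 * h s)%:E + (s ^+ 2)%:E * p1)%E.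
  rewrite -int_tail -ge0_integralZl//=; last 2 first.
  - exact: (m h).
  - by move=> x _; rewrite lee_fin.
  rewrite -ge0_integralD//=.
  - by apply: eq_integral => x _; rewrite -EFinM -EFinD; congr EFin; ring.
  - move=> x; rewrite in_itv/= andbT => sx; rewrite lee_fin mulr_ge0// subr_ge0.
    by rewrite lerXn2r// nnegrE ltW// (lt_le_trans s0).
  - apply: (m (fun x => (x ^+ 2 - s ^+ 2) * h x)).
    under eq_fun do rewrite -[_ ^+ 2]mul1r.
    exact: cxh.
  - by move=> x _; rewrite -EFinM lee_fin mulr_ge0.
  - by apply: measurable_funeM; exact: (m h).
(* The boundary term stays on the left: all integrands are then nonnegative and no extended real is
   subtracted. *)
have aE : (a + (s ^+ 3 * h s)%:E = (s ^+ 2)%:E * p0)%E.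
  rewrite -int_head -ge0_integralZl//=; last 2 first.
  - exact: (m h).
  - by move=> x _; rewrite lee_fin.
  rewrite -ge0_integralD//=.
  - by apply: eq_integral => x _; rewrite -EFinM -EFinD; congr EFin; ring.
  - by move=> x _; rewrite lee_fin.
  - exact: (m (fun x => x ^+ 2 * h x)).
  - move=> x; rewrite in_itv/= => /andP[x0 xs]; rewrite lee_fin mulr_ge0// subr_ge0.
    by rewrite lerXn2r// nnegrE ltW.
  - apply: (m (fun x => (s ^+ 2 - x ^+ 2) * h x)).
    under eq_fun do rewrite addrC -mulN1r.
    exact: cxh.
have : (0 <= p0)%E by apply: integral_ge0 => x _; rewrite lee_fin.
have : (0 <= p1)%E by apply: integral_ge0 => x _; rewrite lee_fin.
(* Since [p0] and [p1] are nonnegative with a finite sum, both are finite; [aE] then makes [a]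
   finite, and [bE] gives [b]. *)
move: p0 p1 a b aE bE => [p0| |] [p1| |] // [a| |] b //=.
move=> [] aE -> _ _ [] pE.
by rewrite -EFinM -!EFinD; congr EFin; rewrite -pE mulrDl [p0 * _]mulrC -aE; ring.
Qed.

Lemma has_integral_sqr_normal_pdf :
  has_integral leb (fun x => x ^+ 2 * normal_pdf 0 s x) (s ^+ 2).
Proof.
apply: has_integral_ge0.
- by apply: measurable_funM => //; exact: measurable_normal_pdf.
- by move=> x; rewrite mulr_ge0 ?sqr_ge0 ?normal_pdf_ge0.
have x2hE : (fun x : R => x ^+ 2 * h x) = (fun x => (1 * x ^+ 2 + 0) * h x).
  by apply/funext => x; rewrite mul1r addr0.
rewrite -/phi phiE ge0_symfun_integralT.
- by rewrite half_integral_sqr_h -EFinM; congr EFin; lra.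
- by move=> x; rewrite mulr_ge0 ?sqr_ge0.
- by rewrite x2hE; exact: cxh.
- by move=> x; rewrite /= /h sqrrN.
Qed.

End gaussian.

Section lebesgue_translation.
Context {R : realType}.
Notation leb := (@lebesgue_measure R).

(** Both sides are measures in [A] that agree on the intervals []a, b]], which determine Lebesgue
    measure. *)
Lemma lebesgue_measure_translation (m : R) (A : set R) : measurable A ->
  leb A = leb ((fun x => x - m) @^-1` A).
Proof.
move=> mA.
have mphi : measurable_fun [set: R] (fun x : R => x - m) by exact: measurable_funB.
apply: (@lebesgue_measure_unique R (pushforward leb
  (fun x : measurableTypeR R => x - m : measurableTypeR R))) => // _ [[a b]] _ <-.
have E : (fun x : R => x - m) @^-1` `]a, b] = `]a + m, b + m]%classic.
  by apply/seteqP; split=> x /=; rewrite !in_itv/= ltrBrDr lerBlDr.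
transitivity (leb `]a + m, b + m]%classic); last by rewrite -E.
rewrite !lebesgue_measure_itv/= !lte_fin ltrD2r.
by case: ifP => // _; rewrite -!EFinB; congr EFin; ring.
Qed.

End lebesgue_translation.

(** * Moments of the Gaussian law of arbitrary mean *)

Section normal_moments.
Context {R : realType}.
Notation leb := (@lebesgue_measure R).
Implicit Types (m s : R).

(** The first moment exists because [1 + x ^+ 2] dominates the absolute value of [x]. The integrand
    is odd, so invariance under reflection makes the integral equal to its opposite. *)
Lemma has_integral_id_normal_pdf s : 0 < s ->
  has_integral leb (fun x => x * normal_pdf 0 s x) 0.
Proof.
move=> s0.
have h0 : has_integral leb (normal_pdf 0 s) 1.
  by split; [exact: integrable_normal_pdf|exact: integral_normal_pdf].
have mf : measurable_fun [set: measurableTypeR R] (fun x : R => x * normal_pdf 0 s x).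
  by apply: measurable_funM => //; exact: measurable_normal_pdf.
have [c hc] : exists c, has_integral leb (fun x => x * normal_pdf 0 s x) c.
  apply: (le_has_integral (has_integralD h0 (has_integral_sqr_normal_pdf s0))) => //.
  move=> x /=; rewrite normrM (ger0_norm (normal_pdf_ge0 _ _ _)).
  rewrite -[X in _ <= X + _]mul1r -mulrDl ler_wpM2r ?normal_pdf_ge0//.
  by rewrite -real_normK ?num_real//; nra.
have hN : has_integral leb (fun x => - (x * normal_pdf 0 s x)) c.
  have mN : measurable_fun [set: measurableTypeR R]
      (-%R : measurableTypeR R -> measurableTypeR R) by [].
  have lN (A : set (measurableTypeR R)) : measurable A -> leb A = leb (-%R @^-1` A).
    by move=> mA; rewrite -lebesgue_measureN.
  apply: eq_has_integral (iffLR (has_integral_pushforward _ mN mf lN) hc) _ _ => // x /=.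
  by rewrite mulNr !normal_pdfE ?gt_eqF// /normal_fun !subr0 sqrrN.
have c0 : c = 0.
  have [_] := hN; have [_] := has_integralZ (-1) hc.
  under eq_integral do rewrite mulN1r.
  by move=> -> [] /eqP; rewrite mulN1r -subr_eq0 => /eqP ?; lra.
by rewrite c0 in hc.
Qed.

(** The density of mean [m] is the centered one translated by [m], so translation invariance reduces
    every moment about [m] to the centered case. *)
Lemma has_integral_normal_prob_shift m s (f : R -> R) c : 0 < s ->
  measurable_fun [set: measurableTypeR R] f ->
  has_integral leb (fun x => f x * normal_pdf 0 s x) c ->
  has_integral (normal_prob m s) (fun x => f (x - m)) c.
Proof.
move=> s0 mf hf.
have mphi : measurable_fun [set: measurableTypeR R]
    (fun x => x - m : measurableTypeR R) by exact: measurable_funB.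
apply: (has_integral_density (mu := leb) (p := normal_pdf m s)).
- exact: normal_prob_dominates.
- exact: measurable_normal_pdf.
- by move=> x; exact: normal_pdf_ge0.
- by [].
- exact: (measurableT_comp mf mphi).
have := iffLR (has_integral_pushforward _ mphi
  (measurable_funM mf (measurable_normal_pdf 0 s))
  (@lebesgue_measure_translation R m)) hf.
move=> /eq_has_integral; apply => // x /=.
by rewrite !normal_pdfE ?gt_eqF// /normal_fun subr0.
Qed.

Lemma normal_moments m s : 0 < s ->
  has_integral (normal_prob m s) idfun m /\
  has_integral (normal_prob m s) (fun x => x ^+ 2) (m ^+ 2 + s ^+ 2).
Proof.
move=> s0.
have h1 := has_integral_normal_prob_shift m s0 (@measurable_id _ _ _)
  (has_integral_id_normal_pdf s0).
have h2 := has_integral_normal_prob_shift m s0 (measurable_funX 2 (@measurable_id _ _ _))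
  (has_integral_sqr_normal_pdf s0).
split.
  apply: eq_has_integral (has_integralD h1 (has_integral_cst _ m)) _ _.
    by move=> x /=; rewrite subrK.
  by rewrite add0r.
apply: eq_has_integral (has_integralD (has_integralD h2 (has_integralZ (2 * m) h1))
  (has_integral_cst _ (m ^+ 2))) _ _.
  by move=> x /=; ring.
by ring.
Qed.

End normal_moments.

(** * Mean and variance of the observed entries *)

Section noise_moments.
Context {d : measure_display} {T : measurableType d} {R : realType}.
Variable P : probability T R.

(** Common to all noise models: the law of [Y] is the image under [phi] of a measure [mu] with known
    moments. These pass from [mu] to the law of [Y], then to [P]. *)
Lemma moments_of_law {d' : measure_display} {T' : measurableType d'}
    (mu : {measure set T' -> \bar R}) (phi : T' -> R) (Y : {RV P >-> R}) m q :
  measurable_fun [set: T'] phi ->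
  (forall A : set R, measurable A -> distribution P Y A = mu (phi @^-1` A)) ->
  has_integral mu phi m -> has_integral mu (fun x => phi x ^+ 2) q ->
  has_integral P Y m /\ has_integral P (fun w => Y w ^+ 2) q.
Proof.
move=> mphi law h1 h2.
have mY : measurable_fun [set: T] Y by [].
have msq : measurable_fun [set: R] (fun x : R => x ^+ 2) by exact: measurable_funX.
have mid : measurable_fun [set: R] (@idfun R) by exact: measurable_id.
have YP (A : set R) : measurable A -> distribution P Y A = P (Y @^-1` A) by [].
split.
  exact: (iffLR (has_integral_pushforward _ mY mid YP)
    (iffRL (has_integral_pushforward _ mphi mid law) h1)).
exact: (iffLR (has_integral_pushforward _ mY msq YP)
    (iffRL (has_integral_pushforward _ mphi msq law) h2)).
Qed.

Lemma gaussian_law_moments (Y : {RV P >-> R}) (m v : R) : 0 < v ->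
  (forall A, measurable A -> distribution P Y A = gaussian_law m v A) ->
  has_integral P Y m /\ has_integral P (fun w => Y w ^+ 2) (m ^+ 2 + v).
Proof.
move=> v0 law.
have sv0 : 0 < Num.sqrt v by rewrite sqrtr_gt0.
have [h1] := normal_moments m sv0.
rewrite sqr_sqrtr ?ltW// => h2.
(* [normal_prob] is a measure on [measurableTypeR R], whereas random variables
   take values in [R]: the same sets are measurable, but the types differ. *)
have mid : measurable_fun [set: measurableTypeR R] (idfun : measurableTypeR R -> R).
  by move=> _ A mA; rewrite setTI.
exact: (moments_of_law mid law h1 h2).
Qed.

Lemma poisson_law_moments (Y : {RV P >-> R}) (l : R) : 0 <= l ->
  (forall A, measurable A -> distribution P Y A = poisson_law l A) ->
  has_integral P Y l /\ has_integral P (fun w => Y w ^+ 2) (l ^+ 2 + l).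
Proof.
move=> l0 law; have [h1 h2] := poisson_moments l0.
have mnat : measurable_fun [set: nat] (fun k : nat => k%:R : R) by [].
exact: (moments_of_law mnat law h1 h2).
Qed.

Lemma poisson_gaussian_law_moments (Y : {RV P >-> R}) (a b x : R) :
  0 < a -> 0 < b -> 0 <= x ->
  (forall A, measurable A ->
    distribution P Y A = poisson_gaussian_law a b x A) ->
  has_integral P Y x /\
  has_integral P (fun w => Y w ^+ 2) (x ^+ 2 + (a * x + b)).
Proof.
move=> a0 b0 x0 law.
have xa0 : 0 <= x / a by rewrite divr_ge0// ltW.
have [p1 p2] := poisson_moments xa0.
have sb0 : 0 < Num.sqrt b by rewrite sqrtr_gt0.
have [g1] := normal_moments 0 sb0.
rewrite sqr_sqrtr ?ltW// => g2.
(* The constant 1 is included so that every monomial in [N] and [e] of degree at most 2 is a product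
   of one factor in each variable. *)
have p0 := has_integral_cst (poisson_prob (x / a) 0) 1.
have g0 := has_integral_cst (normal_prob 0 (Num.sqrt b)) 1.
have p1g0 := has_integral_prod p1 g0.
have p0g1 := has_integral_prod p0 g1.
have p2g0 := has_integral_prod p2 g0.
have p1g1 := has_integral_prod p1 g1.
have p0g2 := has_integral_prod p0 g2.
have a_neq0 : a != 0 by rewrite gt_eqF.
have mphi : measurable_fun [set: nat * measurableTypeR R]
    (fun z : nat * measurableTypeR R => a * z.1%:R + z.2 : R).
  apply: measurable_funD; last exact: measurable_snd.
  apply: measurable_funM => //.
  exact: (measurableT_comp (f := fun k : nat => k%:R : R)).
apply: (moments_of_law (mu := (poisson_prob (x / a) 0 \x normal_prob 0 (Num.sqrt b))%E)
  mphi law).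
(* Mean [a * (x / a) + 0]; then, expanding [(a * N + e) ^+ 2], second moment
   [a ^+ 2 * ((x / a) ^+ 2 + x / a) + 0 + b]. *)
- apply: eq_has_integral (has_integralD (has_integralZ a p1g0) p0g1) _ _.
    by move=> z /=; ring.
  by field.
- apply: eq_has_integral (has_integralD (has_integralD (has_integralZ (a ^+ 2) p2g0)
    (has_integralZ (2 * a) p1g1)) p0g2) _ _.
    by move=> z /=; ring.
  by field.
Qed.

Definition noise_var {n k : nat} (N : noise_model R n k) (X : 'M[R]_(n, k)) i j : R :=
  match N with
  | HomoscedasticGaussian sigma => sigma ^+ 2
  | HeteroscedasticGaussian V => V i j
  | PoissonNoise => X i j
  | MixedPoissonGaussian a b => a * X i j + b
  end.

(** Merges the models into one formula, so that the risk is computed only once. *)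
Lemma noise_diagE {n k : nat} (N : noise_model R n k) (X : 'M[R]_(n, k)) :
  noise_diag N X = diag_mx (\row_j \sum_i noise_var N X i j).
Proof.
have sumE (v : 'M[R]_(n, k)) :
    diag_cv (v^T *m ones n) = diag_mx (\row_j \sum_i v i j).
  congr diag_mx; apply/rowP => j; rewrite !mxE; apply: eq_bigr => i _.
  by rewrite !mxE mulr1.
case: N => [sigma|V||a b] /=; rewrite ?sumE//.
- apply/matrixP => i j; rewrite !mxE sumr_const card_ord.
  by rewrite mulr_natl.
- congr diag_mx; apply/rowP => j; rewrite !mxE; apply: eq_bigr => i _.
  by rewrite !mxE.
Qed.

Lemma noise_moments {n k : nat} (N : noise_model R n k) (X : 'M[R]_(n, k))
    (Y : 'I_n -> 'I_k -> {RV P >-> R}) i j :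
  admissible N X -> follows_noise Y N X ->
  has_integral P (Y i j) (X i j) /\
  has_integral P (fun w => Y i j w ^+ 2) (X i j ^+ 2 + noise_var N X i j).
Proof.
move=> + /(_ i j).
case: N => [sigma|V||a b] /=.
- by move=> s0; apply: gaussian_law_moments; rewrite exprn_gt0.
- by move=> V0; apply: gaussian_law_moments.
- by move=> X0; apply: poisson_law_moments.
- by move=> [a0 b0 X0]; apply: poisson_gaussian_law_moments.
Qed.

End noise_moments.

(** * The risk and its minimizers *)

Section posdef.
Context {R : rcfType} {k : nat}.
Implicit Types (Q : 'M[R]_k) (H : 'M[R]_(k, k)).

(** A nonzero kernel vector would be a zero of the quadratic form. *)
Lemma posdefmx_unit Q : posdefmx Q -> Q \in unitmx.
Proof.
move=> [_ Qpos]; rewrite -unitmx_tr -row_free_unit -kermx_eq0.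
apply/rowV0P => u /sub_kermxP uQ; apply/eqP; apply: contraT => u0.
have := Qpos u^T; rewrite trmxK trmx_eq0 => /(_ u0).
by rewrite -mulmxA -[Q]trmxK -trmx_mul uQ trmx0 mulmx0 mxE ltxx.
Qed.

Lemma invmx_sym Q : posdefmx Q -> (invmx Q)^T = invmx Q.
Proof. by move=> [Qs _]; rewrite trmx_inv Qs. Qed.

Lemma mxtrace_quadE Q H :
  \tr (H^T *m Q *m H) = \sum_j ((col j H)^T *m Q *m col j H) 0 0.
Proof.
apply: eq_bigr => j _.
rewrite tr_col -row_mul !mxE; apply: eq_bigr => i _.
by rewrite !mxE.
Qed.

Lemma mxtrace_quad_ge0 Q H : posdefmx Q -> 0 <= \tr (H^T *m Q *m H).
Proof.
move=> [_ Qpos]; rewrite mxtrace_quadE sumr_ge0// => j _.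
have [->|/Qpos/ltW//] := eqVneq (col j H) 0.
by rewrite mulmx0 mxE.
Qed.

(** The trace is a sum of nonnegative values of the form, one per column; each must vanish, hence
    each column. This yields uniqueness of the minimizers. *)
Lemma mxtrace_quad_eq0 Q H : posdefmx Q ->
  \tr (H^T *m Q *m H) <= 0 -> H = 0.
Proof.
move=> Qpos; have Qge0 := mxtrace_quad_ge0 _ Qpos.
rewrite le_eqVlt ltNge Qge0 orbF mxtrace_quadE psumr_eq0; last first.
  move=> j _; have [->|/Qpos.2/ltW//] := eqVneq (col j H) 0.
  by rewrite mulmx0 mxE.
move=> /allP h0; apply/matrixP => i j.
have /= /eqP hj := h0 j (mem_index_enum j).
have Hj : col j H = 0.
  by apply/eqP; apply: contraT => /Qpos.2; rewrite hj ltxx.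
have -> : H i j = col j H i 0 by rewrite mxE.
by rewrite Hj !mxE.
Qed.

(* With [G = X^T X], this is the risk at [A]. *)
Definition quad_loss (G D A : 'M[R]_k) : R :=
  \tr ((A - 1%:M)^T *m G *m (A - 1%:M)) + \tr (A^T *m D *m A).

(* Completing the square around a point whose gradient is [q *m r^T]. *)
Lemma quad_lossE (G D A B : 'M[R]_k) (q r : 'cV[R]_k) :
  G^T = G -> D^T = D ->
  (G + D) *m A = G + q *m r^T -> (B - A)^T *m q = 0 ->
  quad_loss G D B = quad_loss G D A + \tr ((B - A)^T *m (G + D) *m (B - A)).
Proof.
move=> Gs Ds EA qH; set H := B - A.
have EB : B = A + H by rewrite /H addrC subrK.
(* Half the gradient at [A] is [G *m (A - 1%:M) + D *m A = (G + D) *m A - G = q *m r^T], which [H^T]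
   kills on the left. *)
have E0 : \tr (H^T *m (G *m (A - 1%:M) + D *m A)) = 0.
  rewrite mulmxBr mulmx1 addrAC -mulmxDl EA addrAC subrr add0r.
  by rewrite mulmxA qH mul0mx mxtrace0.
have E1 : \tr (H^T *m G *m (A - 1%:M)) + \tr (H^T *m D *m A) = 0.
  by rewrite -mxtraceD -!mulmxA -mulmxDr.
(* The other cross terms are transposes of those in [E1], by symmetry of [G] and [D]. *)
have E2 : \tr ((A - 1%:M)^T *m G *m H) + \tr (A^T *m D *m H) = 0.
  rewrite -E1; congr (_ + _); rewrite -mxtrace_tr !trmx_mul trmxK mulmxA.
    by rewrite Gs.
  by rewrite Ds.
rewrite /quad_loss EB -addrA [H - _]addrC addrA.
move: E1 E2; set A1 := A - 1%:M.
rewrite !raddfD/= !(mulmxDl, mulmxDr) !raddfD/=.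
lra.
Qed.
End posdef.

(** On the diagonal this is the second moment; off it, independence within row [i] leaves the
    product of the means. *)
Lemma has_integral_prod_entries {d : measure_display} {T : measurableType d}
    {R : realType} (P : probability T R) {n k : nat} (N : noise_model R n k)
    (X : 'M[R]_(n, k)) (Y : 'I_n -> 'I_k -> {RV P >-> R}) i j l :
  admissible N X -> independent_along_rows Y -> follows_noise Y N X ->
  has_integral P (fun w => Y i j w * Y i l w)
    (X i j * X i l + noise_var N X i j *+ (j == l)).
Proof.
move=> Nadm Yind Ylaw.
have [m1 m2] := noise_moments i j Nadm Ylaw.
have [->|jl] := eqVneq j l; last first.
  rewrite addr0; apply: has_integral_indepM m1 (noise_moments i l Nadm Ylaw).1.
  by move=> A B mA mB; apply: mutually_independent_pair.
have [_ m2'] := noise_moments i l Nadm Ylaw.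
by apply: eq_has_integral m2' _ _ => // w; rewrite expr2.
Qed.

(** Used twice, for the random entries and for their means: the two expansions then differ only
    through the expectations of the products [y j * y l]. *)
Lemma sqr_sumE {R : realType} {k : nat} (y t : 'I_k -> R) (x : R) :
  (\sum_j y j * t j - x) ^+ 2 =
  \sum_j \sum_l t j * t l * (y j * y l) + - (2 * x) * (\sum_j t j * y j) + x ^+ 2.
Proof.
have -> : \sum_j t j * y j = \sum_j y j * t j by apply: eq_bigr => j _; rewrite mulrC.
have -> : \sum_j \sum_l t j * t l * (y j * y l) = (\sum_j y j * t j) ^+ 2.
  rewrite expr2 mulr_suml; apply: eq_bigr => j _; rewrite mulr_sumr.
  by apply: eq_bigr => l _; ring.
by ring.
Qed.

Lemma frobenius_norm_sqr {R : rcfType} {m n : nat} (A : 'M[R]_(m, n)) :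
  frobenius_norm A ^+ 2 = \sum_i \sum_j A i j ^+ 2.
Proof.
rewrite sqr_sqrtr// sumr_ge0// => i _; rewrite sumr_ge0// => j _.
exact: sqr_ge0.
Qed.

Lemma frobenius_norm_trace {R : rcfType} {m n : nat} (A : 'M[R]_(m, n)) :
  frobenius_norm A ^+ 2 = \tr (A^T *m A).
Proof.
rewrite frobenius_norm_sqr exchange_big; apply: eq_bigr => j _ /=.
by rewrite mxE; apply: eq_bigr => i _; rewrite mxE expr2.
Qed.

(** * Bias-variance form of the risk *)

Section risk.
Context {d : measure_display} {T : measurableType d} {R : realType}.
Context (P : probability T R) {n k : nat} (N : noise_model R n k).
Context (X : 'M[R]_(n, k)) (Y : 'I_n -> 'I_k -> {RV P >-> R}).
Hypotheses (N_adm : admissible N X) (Y_indep : independent_along_rows Y).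
Hypothesis Y_law : follows_noise Y N X.

Let has_integral_sqr_entry (Theta : 'M[R]_k) i l :
  has_integral P (fun w => (observed_mx Y w *m Theta - X) i l ^+ 2)
    ((X *m Theta - X) i l ^+ 2 + \sum_j noise_var N X i j * Theta j l ^+ 2).
Proof.
have h2 := has_integral_sum (index_enum 'I_k) (Q := predT) (fun j _ =>
  has_integral_sum (index_enum 'I_k) (Q := predT) (fun j' _ =>
    has_integralZ (Theta j l * Theta j' l)
      (has_integral_prod_entries i j j' N_adm Y_indep Y_law))).
have h1 := has_integral_sum (index_enum 'I_k) (Q := predT) (fun j _ =>
  has_integralZ (Theta j l) (noise_moments i j N_adm Y_law).1).
apply: eq_has_integral (has_integralD (has_integralD h2
  (has_integralZ (- (2 * X i l)) h1)) (has_integral_cst P (X i l ^+ 2))) _ _.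
  move=> w /=; rewrite !mxE -sqr_sumE; congr ((_ - _) ^+ 2).
  by apply: eq_bigr => j _; rewrite !mxE.
(* The constant and linear terms coincide on both sides; what remains is the double sum, where only
   the pairs with equal indices carry a variance. *)
rewrite !mxE sqr_sumE [RHS]addrAC; congr (_ + _).
rewrite [RHS]addrAC; congr (_ + _).
rewrite -big_split/=.
apply: eq_bigr => j _.
under eq_bigr do rewrite mulrDr.
rewrite big_split/=; congr (_ + _).
rewrite (bigD1 j)//= eqxx mulr1n big1 ?addr0 => [|l' /negbTE jl]; last first.
  by rewrite eq_sym jl mulr0.
by rewrite expr2 mulrC.
Qed.

Lemma riskE Theta :
  risk Y X Theta = (quad_loss (X^T *m X) (noise_diag N X) Theta)%:E.
Proof.
have h := has_integral_sum (index_enum 'I_n) (Q := predT) (fun i _ =>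
  has_integral_sum (index_enum 'I_k) (Q := predT) (fun l _ =>
    has_integral_sqr_entry Theta i l)).
rewrite /risk unlock.
under eq_integral do rewrite frobenius_norm_sqr.
rewrite h.2; congr EFin.
under eq_bigr do rewrite big_split/=.
rewrite big_split/= /quad_loss; congr (_ + _).
  (* Bias part: [X *m Theta - X = X *m (Theta - 1%:M)]. *)
  rewrite -frobenius_norm_sqr frobenius_norm_trace -[X in _ - X]mulmx1 -mulmxBr.
  by rewrite trmx_mul !mulmxA.
(* Variance part: summing over the rows [i] first produces the diagonal entries of
   [noise_diag N X]. *)
rewrite noise_diagE exchange_big; apply: eq_bigr => l _ /=.
rewrite exchange_big/= -mulmxA mul_diag_mx mxE; apply: eq_bigr => j _.
by rewrite !mxE mulr_suml mulr_sumr; apply: eq_bigr => i _; ring.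
Qed.

End risk.

(** The excess over [f a] is [g (b - a)]: its nonnegativity makes [a] a minimizer, and another
    minimizer [b] would give [g (b - a) <= 0], hence [b = a]. *)
Lemma argmin_quad {A : zmodType} {R : realType} (S : set A) (f : A -> R)
    (g : A -> R) (a : A) : S a ->
  (forall b, S b -> f b = f a + g (b - a)) ->
  (forall b, 0 <= g b) -> (forall b, g b <= 0 -> b = 0) ->
  argmin S (fun b => (f b)%:E) = [set a].
Proof.
move=> Sa fE g0 g0E; apply/seteqP; split=> [b [Sb fb]|_ ->] /=.
  apply/eqP; rewrite -subr_eq0; apply/eqP/g0E.
  by have := fb _ Sa; rewrite lee_fin (fE _ Sb) gerDl.
by split=> // b Sb; rewrite lee_fin (fE _ Sb) lerDl.
Qed.

Theorem proposition1 (d : measure_display) (T : measurableType d)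
    (R : realType) (P : probability T R) (n k : nat)
    (n_ge1 : (1 <= n)%N) (k_ge1 : (1 <= k)%N)
    (X : 'M[R]_(n, k)) (N : noise_model R n k) (N_adm : admissible N X)
    (Y : 'I_n -> 'I_k -> {RV P >-> R})
    (Y_indep : independent_along_rows Y) (Y_law : follows_noise Y N X) :
  let D := noise_diag N X in
  let Q := X^T *m X + D in
  let q := invmx Q *m ones k in
  posdefmx Q ->
  argmin [set: 'M[R]_k] (risk Y X) = [set 1%:M - invmx Q *m D] /\
  argmin [set Theta : 'M[R]_k | Theta^T *m ones k = ones k] (risk Y X) =
    [set 1%:M -
      (invmx Q - (((ones k)^T *m invmx Q *m ones k) 0 0)^-1 *: (q *m q^T))
        *m D].
Proof.
move=> D Q q Qpos.
have -> : risk Y X = fun Theta => (quad_loss (X^T *m X) D Theta)%:E.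
  by apply/funext => Theta; exact: riskE.
have Qunit := posdefmx_unit Qpos.
have Gs : (X^T *m X)^T = X^T *m X by rewrite trmx_mul trmxK.
have Ds : D^T = D by rewrite /D noise_diagE tr_diag_mx.
have QD : Q - D = X^T *m X by rewrite /Q addrK.
set c := (_ *m ones k) 0 0.
have qT : q^T = (ones k)^T *m invmx Q by rewrite trmx_mul invmx_sym.
have q1 : q^T *m ones k = c%:M by rewrite qT [LHS]mx11_scalar.
have Qq : Q *m q = ones k by rewrite mulmxA mulmxV// mul1mx.
(* [c] is the value at [q] of the form of [Q], and [q] is nonzero because [Q *m q = ones k] is, as
   [1 <= k]. *)
have c_neq0 : c != 0.
  have q0 : q != 0.
    apply/eqP => q0; have := Qq; rewrite q0 mulmx0 => /matrixP/(_ (Ordinal k_ge1) 0).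
    by rewrite !mxE => /eqP; rewrite eq_sym oner_eq0.
  by have := Qpos.2 _ q0; rewrite -mulmxA Qq q1 !mxE eqxx => /lt0r_neq0.
have pos := fun H => mxtrace_quad_ge0 H Qpos.
have def := fun H => mxtrace_quad_eq0 (H := H) Qpos.
split.
  apply: (argmin_quad (g := fun H => \tr (H^T *m Q *m H))) => // B _.
  (* Zero gradient: [Q *m (1%:M - invmx Q *m D) = Q - D = X^T *m X]. *)
  apply: (quad_lossE (q := 0) (r := 0)) => //; last by rewrite mulmx0.
  by rewrite mul0mx addr0 mulmxBr mulmx1 mulmxA mulmxV// mul1mx.
set A := 1%:M - _.
(* Feasibility: the bracket sends [ones k] to [q - c^-1 *: (q *m c%:M) = 0]. *)
have A1 : A^T *m ones k = ones k.
  rewrite /A linearB/= trmx1 mulmxBl mul1mx trmx_mul Ds linearB/= invmx_sym//.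
  rewrite linearZ/= trmx_mul trmxK -mulmxA mulmxBl -scalemxAl -mulmxA q1.
  by rewrite mul_mx_scalar scalerA mulVf// scale1r subrr mulmx0 subr0.
apply: (argmin_quad (g := fun H => \tr (H^T *m Q *m H))) => // B B1.
(* The multiplier is read off [Q *m A = Q - D + c^-1 *: (ones k *m q^T *m D)], with
   [q^T *m D = (D *m q)^T]. The difference of two feasible points has a transpose that kills
   [ones k]. *)
apply: (quad_lossE (q := ones k) (r := c^-1 *: (D *m q))) => //.
  rewrite /A mulmxBr mulmx1 mulmxA mulmxBr mulmxV// mulmxBl mul1mx opprB addrCA.
  rewrite QD addrC -scalemxAr mulmxA Qq.
  rewrite [(c^-1 *: _)^T]linearZ/= [(D *m q)^T]trmx_mul Ds.
  by rewrite -scalemxAr -scalemxAl mulmxA.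
by rewrite linearB/= mulmxBl B1 A1 subrr.
Qed.
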